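(* Let $n \geq 3$ and let $K'$ be a subgroup of $K_0$. The action of the subgroup $K'AN \subset K_0AN = Q$ of $SO^o_{n,1}$ on $\mathbb{L}^{n+1}$ is of cohomogeneity one. With $w_0 = e_n - e_{n+1}$, the orbits are exactly the following: (i) the hyperbolic spaces $H^n_+(r)$ and $H^n_-(r)$, $r \in \mathbb{R}_+$; (ii) the single point $\{0\}$, the two open rays $\mathbb{R}_+w_0$ and $\mathbb{R}_-w_0$, and the complements $\mathcal{C}^n_+ \setminus \mathbb{R}_-w_0$ and $\mathcal{C}^n_- \setminus \mathbb{R}_+w_0$; (iii) for each $r \in \mathbb{R}_+$, the two connected components of $\mathbb{S}^n(r) \setminus Z^{n-1}(r)$, and the sets $L + \mathbb{R}w_0$, where $L$ runs through the orbits of the action of $K'$ on the sphere $S^{n-2}(r) \subset Z^{n-1}(r)$.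
   Context: $\mathbb{L}^{n+1}$ is the $(n+1)$-dimensional Minkowski space $\mathbb{R}^{n+1}$ with standard basis $e_1,\dots,e_{n+1}$ and inner product $\langle u,v\rangle = \sum_{i=1}^n u_iv_i - u_{n+1}v_{n+1}$. $SO^o_{n,1}$ is the identity component of the orthogonal group $O_{n,1}$ of $\langle\cdot,\cdot\rangle$, acting linearly on $\mathbb{L}^{n+1}$. An action is of cohomogeneity one if the minimal codimension of its orbits is one. Writing matrices in block form with respect to $\mathbb{R}^{n+1} = \mathbb{R}^{n-1}\oplus\mathbb{R}e_n\oplus\mathbb{R}e_{n+1}$, define the following subgroups of $SO^o_{n,1}$: $$K_0 = \left\{\begin{pmatrix} B & 0 & 0 \\ 0 & 1 & 0 \\ 0 & 0 & 1 \end{pmatrix} : B\in SO_{n-1}\right\},\quad A = \left\{\begin{pmatrix} I_{n-1} & 0 & 0 \\ 0 & \cosh t & -\sinh t \\ 0 & -\sinh t & \cosh t \end{pmatrix} : t\in\mathbb{R}\right\},$$ $$N = \left\{\begin{pmatrix} I_{n-1} & b & b \\ -b^t & 1-\frac12 b^tb & -\frac12 b^tb \\ b^t & \frac12 b^tb & 1+\frac12 b^tb \end{pmatrix} : b\in\mathbb{R}^{n-1}\right\}.$$ $Q = K_0AN$ is a parabolic subgroup of $SO^o_{n,1}$. Notation: $\mathbb{R}_+ = (0,\infty)$, $\mathbb{R}_- = (-\infty,0)$. For $r\in\mathbb{R}_+$: $H^n_\pm(r) = \{v : \langle v,v\rangle = -r^2,\ \pm v_{n+1}>0\}$; $\mathbb{S}^n(r)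 = \{v : \langle v,v\rangle = r^2\}$ (de Sitter space). $\mathcal{C}^n_\pm = \{v : \langle v,v\rangle = 0,\ \pm v_{n+1}>0\}$. $\mathbb{W}^n = \mathbb{R}e_1\oplus\cdots\oplus\mathbb{R}e_{n-1}\oplus\mathbb{R}w_0$. $Z^{n-1}(r) = \mathbb{W}^n\cap\mathbb{S}^n(r) = S^{n-2}(r)\times\mathbb{R}w_0 = \{x+sw_0 : x\in S^{n-2}(r),\ s\in\mathbb{R}\}$, where $S^{n-2}(r)$ is the Euclidean sphere of radius $r$ centered at $0$ in $\mathbb{R}^{n-1} = \mathbb{R}e_1\oplus\cdots\oplus\mathbb{R}e_{n-1}$. *)

(* Defs.v *)
From HB Require Import structures.
From mathcomp Require Import all_boot all_order all_algebra.
From mathcomp Require Import all_classical all_reals all_analysis.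

Set Implicit Arguments.
Unset Strict Implicit.
Unset Printing Implicit Defensive.

Import Order.TTheory GRing.Theory Num.Theory.
Import numFieldNormedType.Exports.

Local Open Scope classical_set_scope.
Local Open Scope ring_scope.

Definition is_subgroup (R : realType) (m : nat) (G : set 'M[R]_m) : Prop :=
  [/\ G 1%:M,
      forall g h, G g -> G h -> G (g *m h) &
      forall g, G g -> g \in unitmx /\ G (invmx g)].

Definition group_orbit (R : realType) (m : nat) (G : set 'M[R]_m) (v : 'cV[R]_m) :
    set 'cV[R]_m :=
  [set g *m v | g in G].

Definition group_orbits (R : realType) (m : nat) (G : set 'M[R]_m) :
    set (set 'cV[R]_m) :=
  [set group_orbit G v | v in setT].

Definition smooth_curve (R : realType) (m : nat) (c : R -> 'cV[R]_m) : Prop :=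
  forall (i : 'I_m) (k : nat) (t : R), derivable (derive1n k (fun s => c s i 0)) t 1.

(* Orbits are in general immersed but not embedded (an orbit can be a dense
   winding of a torus), so neither the subspace topology nor slice charts
   detect their dimension.  The tangent space is seen by the smooth curves of
   the ambient space which stay in the orbit; mere differentiability at one
   point would not do, since a dense set admits such curves in all
   directions. *)
Definition tangent_vector (R : realType) (m : nat) (S : set 'cV[R]_m)
    (p u : 'cV[R]_m) : Prop :=
  exists c : R -> 'cV[R]_m,
    [/\ smooth_curve c, forall t, S (c t), c 0 = p &
        u = \col_i derive1 (fun t => c t i 0) 0].

(* The largest number of linearly independent tangent vectors at p, i.e. the
   dimension of the span of the tangent vectors. *)
Definition tangent_dim (R : realType) (m : nat) (S : set 'cV[R]_m)
    (p : 'cV[R]_m) : nat :=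
  (\max_(d < m.+1 | `[< exists X : d.-tuple 'cV[R]_m,
       free X /\ forall u, u \in X -> tangent_vector S p u >]) d)%N.

Definition orbit_codim (R : realType) (m : nat) (G : set 'M[R]_m)
    (v : 'cV[R]_m) : nat :=
  (m - tangent_dim (group_orbit G v) v)%N.

Definition has_cohomogeneity (R : realType) (m : nat) (G : set 'M[R]_m)
    (c : nat) : Prop :=
  (exists v, orbit_codim G v = c) /\ (forall v, c <= orbit_codim G v)%N.

Definition components (T : topologicalType) (A : set T) : set (set T) :=
  [set connected_component A x | x in A].

(* The dimension n + 1 is written as the block size (n - 1) + 1 + 1, according
   to the decomposition R^(n-1) (+) R e_n (+) R e_(n+1); the two numbers agree
   for n >= 1. *)
Notation mink R n := 'cV[R]_(n.-1 + 1 + 1).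
Notation minkmx R n := 'M[R]_(n.-1 + 1 + 1).

Definition vec3 (R : realType) (n : nat) (x : 'cV[R]_n.-1) (y z : R) :
    mink R n :=
  col_mx (col_mx x y%:M) z%:M.

Definition mx3 (R : realType) (n : nat)
    (a11 : 'M[R]_n.-1) (a12 a13 : 'cV[R]_n.-1)
    (a21 : 'rV[R]_n.-1) (a22 a23 : R)
    (a31 : 'rV[R]_n.-1) (a32 a33 : R) : minkmx R n :=
  block_mx (block_mx a11 a12 a21 a22%:M) (col_mx a13 a23%:M)
           (row_mx a31 a32%:M)           a33%:M.

Definition last_coord (R : realType) (n : nat) (v : mink R n) : R :=
  v (rshift (n.-1 + 1) ord0) 0.

Definition lorentz (R : realType) (n : nat) (u v : mink R n) : R :=
  \sum_(i < n.-1 + 1) u (lshift 1 i) 0 * v (lshift 1 i) 0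
  - last_coord u * last_coord v.

Definition sqnorm (R : realType) (k : nat) (b : 'cV[R]_k) : R :=
  \sum_(i < k) b i 0 ^+ 2.

Definition cosh (R : realType) (t : R) : R := (expR t + expR (- t)) / 2.
Definition sinh (R : realType) (t : R) : R := (expR t - expR (- t)) / 2.

Definition SO (R : realType) (k : nat) : set 'M[R]_k :=
  [set B | B^T *m B = 1%:M /\ \det B = 1].
Arguments SO : clear implicits.

Definition K0_group (R : realType) (n : nat) : set (minkmx R n) :=
  [set mx3 B 0 0
           0 1 0
           0 0 1 | B in SO R n.-1].
Arguments K0_group : clear implicits.

Definition A_group (R : realType) (n : nat) : set (minkmx R n) :=
  [set mx3 1%:M 0           0
           0    (cosh t)    (- sinh t)
           0    (- sinh t)  (cosh t) | t in [set: R]].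
Arguments A_group : clear implicits.

Definition N_group (R : realType) (n : nat) : set (minkmx R n) :=
  [set mx3 1%:M    b                        b
           (- b^T) (1 - 2^-1 * sqnorm b)    (- (2^-1 * sqnorm b))
           b^T     (2^-1 * sqnorm b)        (1 + 2^-1 * sqnorm b)
       | b in [set: 'cV[R]_n.-1]].
Arguments N_group : clear implicits.

Definition KAN (R : realType) (n : nat) (K : set (minkmx R n)) :
    set (minkmx R n) :=
  [set g | exists k a h, [/\ K k, A_group R n a, N_group R n h & g = k *m a *m h]].

Definition w0 (R : realType) (n : nat) : mink R n :=
  vec3 0 1 0 - vec3 0 0 1.
Arguments w0 : clear implicits.

Definition Hplus (R : realType) (n : nat) (r : R) : set (mink R n) :=
  [set v | lorentz v v = - r ^+ 2 /\ last_coord v > 0].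
Arguments Hplus : clear implicits.

Definition Hminus (R : realType) (n : nat) (r : R) : set (mink R n) :=
  [set v | lorentz v v = - r ^+ 2 /\ - last_coord v > 0].
Arguments Hminus : clear implicits.

Definition deSitter (R : realType) (n : nat) (r : R) : set (mink R n) :=
  [set v | lorentz v v = r ^+ 2].
Arguments deSitter : clear implicits.

Definition Cplus (R : realType) (n : nat) : set (mink R n) :=
  [set v | lorentz v v = 0 /\ last_coord v > 0].
Arguments Cplus : clear implicits.

Definition Cminus (R : realType) (n : nat) : set (mink R n) :=
  [set v | lorentz v v = 0 /\ - last_coord v > 0].
Arguments Cminus : clear implicits.

Definition posray (R : realType) (n : nat) : set (mink R n) :=
  [set s *: w0 R n | s in [set s : R | 0 < s]].
Arguments posray : clear implicits.

Definition negray (R : realType) (n : nat) : set (mink R n) :=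
  [set s *: w0 R n | s in [set s : R | s < 0]].
Arguments negray : clear implicits.

Definition W_hyperplane (R : realType) (n : nat) : set (mink R n) :=
  [set v | exists (x : 'cV[R]_n.-1) (s : R), v = vec3 x 0 0 + s *: w0 R n].
Arguments W_hyperplane : clear implicits.

Definition Z_cylinder (R : realType) (n : nat) (r : R) : set (mink R n) :=
  W_hyperplane R n `&` deSitter R n r.
Arguments Z_cylinder : clear implicits.

(* S^(n-2)(r), inside R^(n-1) = R e_1 (+) ... (+) R e_(n-1). *)
Definition sphere (R : realType) (n : nat) (r : R) : set (mink R n) :=
  [set vec3 x 0 0 | x in [set x : 'cV[R]_n.-1 | sqnorm x = r ^+ 2]].
Arguments sphere : clear implicits.

Definition add_line (R : realType) (n : nat) (L : set (mink R n)) :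
    set (mink R n) :=
  [set v | exists2 x, L x & exists s : R, v = x + s *: w0 R n].

Definition orbit_list (R : realType) (n : nat) (K : set (minkmx R n)) :
    set (set (mink R n)) :=
  [set S |
   [\/ exists2 r : R, 0 < r & S = Hplus R n r \/ S = Hminus R n r,
       [\/ S = [set 0],
           S = posray R n \/ S = negray R n |
           S = Cplus R n `\` negray R n \/ S = Cminus R n `\` posray R n] |
       exists2 r : R, 0 < r &
         components (deSitter R n r `\` Z_cylinder R n r) S \/
         exists2 x, sphere R n r x & S = add_line (group_orbit K x)]].

(* Main.v *)
Require Import Defs.
From HB Require Import structures.
From mathcomp Require Import all_boot all_order all_algebra.
From mathcomp Require Import all_classical all_reals all_analysis.
From mathcomp Require Import ring lra.

Set Implicit Arguments.
Unset Strict Implicit.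
Unset Printing Implicit Defensive.

Import Order.TTheory GRing.Theory Num.Theory.
Import numFieldNormedType.Exports.

Local Open Scope classical_set_scope.
Local Open Scope ring_scope.

(** The theorem becomes a computation in light-cone coordinates.  Write a
    vector as (x, p, q) with x in R^(n-1), p = y + z and q = y - z, where y and
    z are its last two coordinates.  Then <v, v> = |x|^2 + p q, the vector w0
    is (0, 0, 2), and the product of the rotation by B, the boost of
    parameter t and the element of N of parameter b acts by
    [(x, p, q) |-> (B (x + p b), e^-t p, e^t (q - 2 b.x - p |b|^2))]
    ([KAN_lc]).  So <v, v> and the sign of p are invariant.

    If p <> 0, the parameter b moves x anywhere, t gives p any value of its
    sign, and q is then determined by <v, v>: the orbit is a whole sheet
    {<v, v> = c, sign of p = s} ([orbit_sheet]).  If p = 0 and x <> 0, the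
    vector x only moves by K' while q becomes arbitrary, so the orbit is
    K' x + R w0 ([orbit_line]).  If p = 0 and x = 0, only the rescaling of q
    by e^t is left, which gives the two rays and the origin ([orbit_ray],
    [orbit_0]).

    It remains to recognise the sheets.  For c < 0 and c = 0, the equation
    |x|^2 + p q = c ties the sign of p to that of the time coordinate
    ([sheet_hyperbolic], [sheet_cone]).  For c = r^2 the set Z is the locus
    p = 0 of de Sitter space, so its complement is the union of two sheets;
    each is connected, being parametrised by x and log |p|, and p cannot
    change sign on a connected subset ([deSitter_components]).

    For the cohomogeneity, a curve in an orbit keeps <v, v> constant, so its
    velocity at v is orthogonal to v; as the form is nondegenerate, this
    bounds the tangent dimension by n when v <> 0, and the orbit of 0 is a
    point.  The orbit of e_(n+1) is the hyperboloid H_+(1), where the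
    hyperbolas cosh t e_(n+1) + sinh t e_i supply n independent tangent
    vectors. *)

(** * The Euclidean inner product *)

Definition dot (R : realType) (k : nat) (b x : 'cV[R]_k) : R :=
  \sum_(i < k) b i 0 * x i 0.

Lemma dotE (R : realType) (k : nat) (b x : 'cV[R]_k) : (b^T *m x) 0 0 = dot b x.
Proof. by rewrite mxE; apply: eq_bigr => i _; rewrite mxE. Qed.

Lemma dotxx (R : realType) (k : nat) (x : 'cV[R]_k) : dot x x = sqnorm x.
Proof. by apply: eq_bigr => i _; rewrite expr2. Qed.

Lemma dotC (R : realType) (k : nat) (x y : 'cV[R]_k) : dot x y = dot y x.
Proof. by apply: eq_bigr => i _; rewrite mulrC. Qed.

Lemma dotDr (R : realType) (k : nat) (b x y : 'cV[R]_k) :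
  dot b (x + y) = dot b x + dot b y.
Proof. by rewrite -!dotE mulmxDr mxE. Qed.

Lemma dotDl (R : realType) (k : nat) (b x y : 'cV[R]_k) :
  dot (x + y) b = dot x b + dot y b.
Proof. by rewrite !(dotC _ b) dotDr. Qed.

Lemma dotZr (R : realType) (k : nat) (b x : 'cV[R]_k) a :
  dot b (a *: x) = a * dot b x.
Proof. by rewrite -!dotE -scalemxAr mxE. Qed.

Lemma dotZl (R : realType) (k : nat) (b x : 'cV[R]_k) a :
  dot (a *: x) b = a * dot x b.
Proof. by rewrite !(dotC _ b) dotZr. Qed.

Lemma dot0r (R : realType) (k : nat) (b : 'cV[R]_k) : dot b 0 = 0.
Proof. by rewrite -dotE mulmx0 mxE. Qed.

Lemma sqnormD (R : realType) (k : nat) (x y : 'cV[R]_k) :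
  sqnorm (x + y) = sqnorm x + 2 * dot x y + sqnorm y.
Proof. by rewrite -!dotxx dotDl !dotDr (dotC y x); ring. Qed.

Lemma sqnormZ (R : realType) (k : nat) (x : 'cV[R]_k) a :
  sqnorm (a *: x) = a ^+ 2 * sqnorm x.
Proof. by rewrite -!dotxx dotZl dotZr mulrA -expr2. Qed.

Lemma sqnorm0 (R : realType) (k : nat) : sqnorm (0 : 'cV[R]_k) = 0.
Proof. by rewrite -dotxx dot0r. Qed.

Lemma sqnorm_ge0 (R : realType) (k : nat) (x : 'cV[R]_k) : 0 <= sqnorm x.
Proof. by apply: sumr_ge0 => i _; apply: sqr_ge0. Qed.

Lemma sqnorm_eq0 (R : realType) (k : nat) (x : 'cV[R]_k) :
  sqnorm x = 0 -> x = 0.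
Proof.
move=> x0; apply/colP => i; rewrite mxE; apply/eqP; rewrite -sqrf_eq0.
apply/eqP.
exact: (psumr_eq0P (fun j _ => sqr_ge0 (x j 0)) x0).
Qed.

Lemma SO_orthogonal (R : realType) (k : nat) (B : 'M[R]_k) :
  SO R k B -> B *m B^T = 1%:M.
Proof. by case=> /mulmx1C. Qed.

Lemma dot_adjoint (R : realType) (k : nat) (B : 'M[R]_k) (b x : 'cV[R]_k) :
  dot (B^T *m b) x = dot b (B *m x).
Proof. by rewrite -!dotE trmx_mul trmxK mulmxA. Qed.

Lemma sqnorm_SO (R : realType) (k : nat) (B : 'M[R]_k) (x : 'cV[R]_k) :
  SO R k B -> sqnorm (B *m x) = sqnorm x.
Proof.
by case=> BB _; rewrite -!dotxx -dot_adjoint mulmxA BB mul1mx.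
Qed.

(** * Light-cone coordinates *)

(** The vector whose last two coordinates y, z satisfy y + z = p and
    y - z = q.  The null directions q and p are the eigendirections of the
    boosts, with eigenvalues e^t and e^-t. *)
Definition lc (R : realType) (n : nat) (x : 'cV[R]_n.-1) (p q : R) : mink R n :=
  vec3 x ((p + q) / 2) ((p - q) / 2).

Lemma mx3_vec3 (R : realType) (n : nat)
    (a11 : 'M[R]_n.-1) (a12 a13 : 'cV[R]_n.-1)
    (a21 : 'rV[R]_n.-1) (a22 a23 : R)
    (a31 : 'rV[R]_n.-1) (a32 a33 : R) (x : 'cV[R]_n.-1) (y z : R) :
  mx3 a11 a12 a13 a21 a22 a23 a31 a32 a33 *m vec3 x y z =
  vec3 (a11 *m x + y *: a12 + z *: a13)
       ((a21 *m x) 0 0 + a22 * y + a23 * z)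
       ((a31 *m x) 0 0 + a32 * y + a33 * z).
Proof.
rewrite /mx3 /vec3 mul_block_col mul_block_col mul_col_mx mul_row_col.
rewrite add_col_mx !mul_mx_scalar [a21 *m x]mx11_scalar [a31 *m x]mx11_scalar.
rewrite !scale_scalar_mx -!raddfD /= !(mulrC _ y) !(mulrC _ z).
by rewrite ![_%:M 0 0]mxE !mulr1n.
Qed.

Lemma vec3P (R : realType) (n : nat) (v : mink R n) :
  exists x y z, v = vec3 x y z.
Proof.
exists (usubmx (usubmx v)), (dsubmx (usubmx v) 0 0), (dsubmx v 0 0).
by rewrite /vec3 -!mx11_scalar !vsubmxK.
Qed.

Lemma vec3_inj (R : realType) (n : nat) (x x' : 'cV[R]_n.-1) (y y' z z' : R) :
  vec3 x y z = vec3 x' y' z' -> [/\ x = x', y = y' & z = z'].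
Proof.
move=> /eq_col_mx[/eq_col_mx[-> /matrixP/(_ 0 0)]] + /matrixP/(_ 0 0).
by rewrite !mxE eqxx !mulr1n => -> ->.
Qed.

Lemma lcP (R : realType) (n : nat) (v : mink R n) : exists x p q, v = lc x p q.
Proof.
have [x [y [z ->]]] := vec3P v; exists x, (y + z), (y - z).
by rewrite /lc; congr vec3; field.
Qed.

Lemma lc_inj (R : realType) (n : nat) (x x' : 'cV[R]_n.-1) (p p' q q' : R) :
  lc x p q = lc x' p' q' -> [/\ x = x', p = p' & q = q'].
Proof. by move=> /vec3_inj[-> ? ?]; split=> //; lra. Qed.

Lemma last_coord_vec3 (R : realType) (n : nat) (x : 'cV[R]_n.-1) (y z : R) :
  last_coord (vec3 x y z) = z.
Proof. by rewrite /last_coord /vec3 col_mxEd mxE eqxx mulr1n. Qed.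

Lemma lorentz_vec3 (R : realType) (n : nat) (x x' : 'cV[R]_n.-1)
    (y y' z z' : R) :
  lorentz (vec3 x y z) (vec3 x' y' z') = dot x x' + y * y' - z * z'.
Proof.
rewrite /lorentz !last_coord_vec3; congr (_ - _).
rewrite big_split_ord /= big_ord1; congr (_ + _).
  by apply: eq_bigr => i _; rewrite !col_mxEu.
by rewrite !col_mxEu !col_mxEd !mxE eqxx !mulr1n.
Qed.

Lemma lorentz_lc (R : realType) (n : nat) (x : 'cV[R]_n.-1) (p q : R) :
  lorentz (lc x p q) (lc x p q) = sqnorm x + p * q.
Proof. by rewrite lorentz_vec3 dotxx; field. Qed.

Lemma last_coord_lc (R : realType) (n : nat) (x : 'cV[R]_n.-1) (p q : R) :
  last_coord (lc x p q) = (p - q) / 2.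
Proof. exact: last_coord_vec3. Qed.

Lemma w0_lc (R : realType) (n : nat) : w0 R n = lc 0 0 2.
Proof.
rewrite /w0 /vec3 /lc opp_col_mx add_col_mx opp_col_mx add_col_mx subr0.
rewrite -!raddfB /=; congr (col_mx (col_mx _ _%:M) _%:M); lra.
Qed.

Lemma lc0 (R : realType) (n : nat) : lc 0 0 0 = 0 :> mink R n.
Proof. by rewrite /lc /vec3 addr0 subr0 mul0r raddf0 !col_mx0. Qed.

Lemma lc_lin (R : realType) (n : nat) a (x x' : 'cV[R]_n.-1) (p p' q q' : R) :
  lc x p q + a *: lc x' p' q' = lc (x + a *: x') (p + a * p') (q + a * q').
Proof.
rewrite /lc /vec3 !scale_col_mx !add_col_mx !scale_scalar_mx -!raddfD /=.
congr (col_mx (col_mx _ _%:M) _%:M); ring.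
Qed.

(** * The group K'AN in light-cone coordinates *)

Definition rotation (R : realType) (n : nat) (B : 'M[R]_n.-1) : minkmx R n :=
  mx3 B 0 0  0 1 0  0 0 1.

Definition boost (R : realType) (n : nat) (t : R) : minkmx R n :=
  mx3 1%:M 0 0  0 (cosh t) (- sinh t)  0 (- sinh t) (cosh t).
Arguments boost {R} n t.

(** The elements of N fix the null vector w0; they are the translations of
    the horospheres centred at its direction. *)
Definition horo (R : realType) (n : nat) (b : 'cV[R]_n.-1) : minkmx R n :=
  mx3 1%:M b b
      (- b^T) (1 - 2^-1 * sqnorm b) (- (2^-1 * sqnorm b))
      b^T (2^-1 * sqnorm b) (1 + 2^-1 * sqnorm b).

Lemma vec3_lc (R : realType) (n : nat) (x : 'cV[R]_n.-1) :
  vec3 x 0 0 = lc x 0 0 :> mink R n.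
Proof. by rewrite /lc addr0 subr0 mul0r. Qed.

Lemma rotation_lc (R : realType) (n : nat) (B : 'M[R]_n.-1) x p q :
  rotation B *m lc x p q = lc (B *m x) p q.
Proof.
rewrite mx3_vec3 !mul0mx !scaler0 !addr0 /lc !mxE; congr vec3; ring.
Qed.

Lemma expRNK (R : realType) (t : R) : expR (- t) * expR t = 1.
Proof. by rewrite mulrC expRxMexpNx_1. Qed.

Lemma boost_lc (R : realType) (n : nat) (t : R) (x : 'cV[R]_n.-1) p q :
  boost n t *m lc x p q = lc x (expR (- t) * p) (expR t * q).
Proof.
rewrite mx3_vec3 mul1mx !mul0mx !scaler0 !addr0 /lc !mxE /cosh /sinh.
by congr vec3; field.
Qed.

Lemma horo_lc (R : realType) (n : nat) (b : 'cV[R]_n.-1) x p q :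
  horo b *m lc x p q = lc (x + p *: b) p (q - 2 * dot b x - p * sqnorm b).
Proof.
rewrite mx3_vec3 mul1mx mulNmx mxE !dotE /lc -addrA -scalerDl.
congr vec3; [congr (_ + _ *: _); by field | by field | by field].
Qed.

(** Reduces identities in the group to identities between actions on
    light-cone coordinates, where the block matrices disappear. *)
Lemma mink_mx_ext (R : realType) (n : nat) (g h : minkmx R n) :
  (forall x p q, g *m lc x p q = h *m lc x p q) -> g = h.
Proof.
move=> gh; apply/matrixP => i j.
have [x [p [q E]]] := lcP (delta_mx j 0 : mink R n).
have := gh x p q; rewrite -E -!colE => /colP/(_ i).
by rewrite !mxE.
Qed.

Lemma KANP (R : realType) (n : nat) (K : set (minkmx R n)) (g : minkmx R n) :
  K `<=` K0_group R n ->
  KAN K g <-> exists B t b,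
    [/\ SO R n.-1 B, K (rotation B) & g = rotation B *m boost n t *m horo b].
Proof.
move=> KK0; split.
  move=> [k [_ [_ [Kk [t _ <-] [b _ <-] ->]]]]; have [B SB Bk] := KK0 _ Kk.
  by exists B, t, b; rewrite /rotation Bk.
move=> [B [t [b [_ KB ->]]]]; exists (rotation B), (boost n t), (horo b).
by split=> //; [exists t | exists b].
Qed.

Lemma KAN_lc (R : realType) (n : nat) (B : 'M[R]_n.-1) t b x p q :
  rotation B *m boost n t *m horo b *m lc x p q =
  lc (B *m (x + p *: b)) (expR (- t) * p)
     (expR t * (q - 2 * dot b x - p * sqnorm b)).
Proof. by rewrite -!mulmxA horo_lc boost_lc rotation_lc. Qed.

Lemma rotation1 (R : realType) (n : nat) : rotation (1%:M : 'M[R]_n.-1) = 1%:M.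
Proof. by apply: mink_mx_ext => x p q; rewrite rotation_lc !mul1mx. Qed.

Lemma rotationM (R : realType) (n : nat) (B C : 'M[R]_n.-1) :
  rotation B *m rotation C = rotation (B *m C).
Proof. by apply: mink_mx_ext => x p q; rewrite -mulmxA !rotation_lc mulmxA. Qed.

Lemma SO1 (R : realType) (k : nat) : SO R k 1%:M.
Proof. by split; rewrite ?det1 // trmx1 mul1mx. Qed.

Lemma SOM (R : realType) (k : nat) (B C : 'M[R]_k) :
  SO R k B -> SO R k C -> SO R k (B *m C).
Proof.
move=> [BB dB] [CC dC]; split; last by rewrite det_mulmx dB dC mulr1.
by rewrite trmx_mul mulmxA -(mulmxA C^T) BB mulmx1.
Qed.

Lemma SOT (R : realType) (k : nat) (B : 'M[R]_k) : SO R k B -> SO R k B^T.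
Proof.
by move=> SB; split; [rewrite trmxK SO_orthogonal | rewrite det_tr; case: SB].
Qed.

Lemma subgroup_rotationT (R : realType) (n : nat) (K : set (minkmx R n))
    (B : 'M[R]_n.-1) :
  is_subgroup K -> SO R n.-1 B -> K (rotation B) -> K (rotation B^T).
Proof.
move=> [_ _ KV] SB /KV[uB].
suff -> : rotation B^T = invmx (rotation B) by [].
rewrite -[LHS](mulKmx uB) rotationM (SO_orthogonal SB) rotation1 mulmx1 //.
Qed.

(** AN is normalised by K' and N by A, so a product of two elements can be
    brought back to the form k a h. *)
Lemma KAN_subgroup (R : realType) (n : nat) (K : set (minkmx R n)) :
  is_subgroup K -> K `<=` K0_group R n -> is_subgroup (KAN K).
Proof.
move=> sK KK0; have [K1 KM KV] := sK; split.
- apply/(KANP _ KK0); exists 1%:M, 0, 0; split; rewrite ?rotation1 //.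
    exact: SO1.
  apply: mink_mx_ext => x p q; rewrite -rotation1 KAN_lc rotation_lc.
  rewrite scaler0 addr0 dotC dot0r sqnorm0 oppr0 expR0; congr lc; ring.
- move=> g h /(KANP _ KK0)[B [t [b [SB KB ->]]]].
  move=> /(KANP _ KK0)[C [u [c [SC KC ->]]]].
  apply/(KANP _ KK0).
  (* Moving h(b) to the right past the rotation by C turns b into C^T b, and
     past the boost u multiplies it by e^-u. *)
  exists (B *m C), (t + u), (c + expR (- u) *: (C^T *m b)).
  split; [exact: SOM | by rewrite -rotationM; apply: KM |].
  apply: mink_mx_ext => x p q; rewrite -mulmxA !KAN_lc.
  have uV := expRNK u.
  rewrite opprD !expRD; congr lc.
  + rewrite -mulmxA; congr (B *m _); rewrite scalerDr addrA [RHS]mulmxDr.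
    rewrite -!scalemxAr mulmxA SO_orthogonal // mul1mx scalerA.
    by rewrite (mulrC p).
  + ring.
  + rewrite sqnormD sqnormZ dotZr dotDl dotZl dot_adjoint (sqnorm_SO _ (SOT SC)).
    rewrite (dotC c (C^T *m b)) dot_adjoint mulmxDr dotDr -scalemxAr dotZr.
    by field: uV.
- move=> g0 /(KANP _ KK0)[B [t [b [SB KB ->]]]].
  (* h(-b) a(-t) rotation(B^T), with the rotation and the boost moved to the
     left. *)
  pose h := rotation B^T *m boost n (- t) *m horo (- expR t *: (B *m b)).
  have Kh : KAN K h.
    apply/(KANP _ KK0); exists B^T, (- t), (- expR t *: (B *m b)).
    by split=> //; [exact: SOT | exact: subgroup_rotationT].
  set g := _ *m _ *m _; suff gh : h *m g = 1%:M.
    have [_ ug] := mulmx1_unit gh; split => //.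
    by rewrite -[invmx g]mul1mx -gh mulmxK.
  apply: mink_mx_ext => x p q; rewrite -mulmxA !KAN_lc mul1mx.
  have tV := expRNK t.
  have SBB y : B^T *m (B *m y) = y.
    by rewrite mulmxA; case: SB => ->; rewrite mul1mx.
  rewrite opprK; congr lc.
  + rewrite scaleNr scalerN scalerA mulrAC tV mul1r mulmxBr -scalemxAr !SBB.
    by rewrite addrK.
  + by ring: tV.
  + rewrite sqnormZ dotZl -dot_adjoint SBB (sqnorm_SO _ SB) dotDr dotZr dotxx.
    by field: tV.
Qed.

(** * Orbits of K'AN *)

(** The coordinate p.  It is the product <v, w0>, so its zero locus is the null
    hyperplane W. *)
Definition pcoord (R : realType) (n : nat) (v : mink R n) : R :=
  v (lshift 1 (rshift n.-1 ord0)) 0 + last_coord v.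

Lemma pcoord_lc (R : realType) (n : nat) (x : 'cV[R]_n.-1) p q :
  pcoord (lc x p q) = p.
Proof.
rewrite /pcoord last_coord_lc /lc /vec3 col_mxEu col_mxEd mxE eqxx mulr1n.
by field.
Qed.

(** The hyperboloids, the truncated cones and the pieces of de Sitter space
    off Z are all of this form, with s = 1 or s = -1. *)
Definition sheet (R : realType) (n : nat) (c s : R) : set (mink R n) :=
  [set v | lorentz v v = c /\ 0 < s * pcoord v].
Arguments sheet {R} n c s.

Definition ray (R : realType) (n : nat) (s : R) : set (mink R n) :=
  [set v | exists2 q, 0 < s * q & v = lc 0 0 q].
Arguments ray {R} n s.

Definition is_sign (R : realType) (s : R) : Prop := s = 1 \/ s = -1.

Lemma sign_sqr (R : realType) (s : R) : is_sign s -> s * s = 1.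
Proof. by case=> ->; rewrite ?mulrNN mulr1. Qed.

Lemma signP (R : realType) (p : R) : p != 0 -> exists2 s, is_sign s & 0 < s * p.
Proof.
case: (ltgtP p 0) => // p0 _.
  by exists (-1); [right | rewrite mulN1r oppr_gt0].
by exists 1; [left | rewrite mul1r].
Qed.

Lemma same_sign_div (R : realType) (s p q : R) :
  0 < s * p -> 0 < s * q -> 0 < p / q.
Proof.
move=> sp sq; have s0 : s != 0 by apply: contraTneq sp => ->; rewrite mul0r ltxx.
have q0 : q != 0 by apply: contraTneq sq => ->; rewrite mulr0 ltxx.
have -> : p / q = (s * p) / (s * q) by field; apply/andP.
by rewrite divr_gt0.
Qed.

Section Orbits.
Variables (R : realType) (n : nat) (K : set (minkmx R n)).
Hypotheses (sK : is_subgroup K) (KK0 : K `<=` K0_group R n).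

Lemma orbit_lcP (x : 'cV[R]_n.-1) p q v :
  group_orbit (KAN K) (lc x p q) v <-> exists B t b,
    [/\ SO R n.-1 B, K (rotation B) &
        v = lc (B *m (x + p *: b)) (expR (- t) * p)
              (expR t * (q - 2 * dot b x - p * sqnorm b))].
Proof.
split.
  move=> [g /(KANP _ KK0)[B [t [b [SB KB ->]]]] <-].
  by exists B, t, b; rewrite KAN_lc.
move=> [B [t [b [SB KB ->]]]].
exists (rotation B *m boost n t *m horo b); last by rewrite KAN_lc.
by apply/(KANP _ KK0); exists B, t, b.
Qed.

Lemma KAN_lorentz g v : KAN K g -> lorentz (g *m v) (g *m v) = lorentz v v.
Proof.
move=> /(KANP _ KK0)[B [t [b [SB _ ->]]]]; have [x [p [q ->]]] := lcP v.
rewrite KAN_lc !lorentz_lc sqnorm_SO // sqnormD sqnormZ dotZr (dotC x).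
have tV := expRNK t.
by ring: tV.
Qed.

Lemma K_rotation1 : K (rotation 1%:M).
Proof. by rewrite rotation1; case: sK. Qed.

(** Where p <> 0, the horospherical translations act transitively on x and the
    boosts on the values of p of a given sign; the quadratic form then leaves
    no freedom for q. *)
Lemma orbit_sheet s (x : 'cV[R]_n.-1) p q : is_sign s -> 0 < s * p ->
  group_orbit (KAN K) (lc x p q) = sheet n (sqnorm x + p * q) s.
Proof.
move=> ss sp; apply/seteqP; split=> v.
  move=> /[dup] -[g Kg gv] /orbit_lcP[B [t [b [_ _ vE]]]]; split.
    by rewrite -gv (KAN_lorentz _ Kg) lorentz_lc.
  by rewrite vE pcoord_lc mulrCA mulr_gt0 // expR_gt0.
have [x' [p' [q' ->]]] := lcP v; rewrite /sheet /= lorentz_lc pcoord_lc => -[Q sp'].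
have p0 : p != 0 by apply: contraTneq sp => ->; rewrite mulr0 ltxx.
have p'0 : p' != 0 by apply: contraTneq sp' => ->; rewrite mulr0 ltxx.
have pp := same_sign_div sp sp'.
apply/orbit_lcP; exists 1%:M, (ln (p / p')), (p^-1 *: (x' - x)).
split; [exact: SO1 | exact: K_rotation1 |].
rewrite expRN lnK ?posrE // mul1mx scalerA divff // scale1r addrC subrK.
congr lc; first by field; apply/andP.
rewrite sqnormZ dotZl.
have -> : sqnorm (x' - x) = sqnorm x' - sqnorm x - 2 * dot (x' - x) x.
  by rewrite -{2}[x'](subrK x) (sqnormD _ x); ring.
have -> : q' = (sqnorm x + p * q - sqnorm x') / p' by rewrite -Q; field.
by field; apply/andP.
Qed.

(** Where p = 0 and x <> 0, the element of parameter b shifts q by -2 b.x and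
    keeps x fixed; b parallel to x already reaches every q. *)
Lemma orbit_line (x : 'cV[R]_n.-1) q : x != 0 ->
  group_orbit (KAN K) (lc x 0 q) = add_line (group_orbit K (lc x 0 0)).
Proof.
move=> x0; apply/seteqP; split=> v.
  move=> /orbit_lcP[B [t [b [SB KB ->]]]].
  exists (lc (B *m x) 0 0); first by exists (rotation B); rewrite ?rotation_lc.
  exists (expR t * (q - 2 * dot b x) / 2).
  rewrite w0_lc lc_lin scaler0 scale0r !addr0.
  by congr lc; field.
move=> [_ [k Kk <-] [s ->]]; have [B SB Bk] := KK0 Kk.
(* q must become 2 s because w0 has q-coordinate 2. *)
apply/orbit_lcP; exists B, 0, ((q - 2 * s) / (2 * sqnorm x) *: x).
split; rewrite /rotation ?Bk // -Bk rotation_lc w0_lc lc_lin.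
rewrite oppr0 expR0 scale0r scaler0 dotZl dotxx !addr0.
have xx : sqnorm x != 0 by apply: contra_neq x0; exact: sqnorm_eq0.
by congr lc; field.
Qed.

Lemma orbit_ray s q : is_sign s -> 0 < s * q ->
  group_orbit (KAN K) (lc 0 0 q) = ray n s.
Proof.
move=> ss sq; apply/seteqP; split=> v.
  move=> /orbit_lcP[B [t [b [SB KB ->]]]].
  rewrite scale0r addr0 mulmx0 dot0r mulr0 mul0r mulr0 !subr0.
  by eexists; last reflexivity; rewrite mulrCA mulr_gt0 // expR_gt0.
move=> [q' sq' ->]; apply/orbit_lcP; exists 1%:M, (ln (q' / q)), 0.
have q0 : q != 0 by apply: contraTneq sq => ->; rewrite mulr0 ltxx.
have qq := same_sign_div sq' sq.
split; [exact: SO1 | exact: K_rotation1 |].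
rewrite scale0r addr0 mulmx0 dot0r mulr0 mul0r mulr0 !subr0 lnK ?posrE //.
by rewrite divfK.
Qed.

Lemma orbit_0 : group_orbit (KAN K) 0 = [set 0].
Proof.
apply/seteqP; split=> v; first by move=> [g _ <-]; rewrite mulmx0.
move=> ->; exists 1%:M; last by rewrite mulmx0.
by case: (KAN_subgroup sK KK0).
Qed.

End Orbits.

(** * The orbits as hyperboloids, cones and de Sitter pieces *)

Lemma sheet_neq0 (R : realType) (n : nat) (c s : R) :
  is_sign s -> sheet n c s (lc 0 s (s * c)).
Proof.
move=> ss; split; last by rewrite pcoord_lc sign_sqr.
by rewrite lorentz_lc sqnorm0 add0r mulrA sign_sqr // mul1r.
Qed.

(** On a negative level p q < 0, so z = (p - q) / 2 has the sign of p. *)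
Lemma sheet_hyperbolic (R : realType) (n : nat) (r s : R) : is_sign s -> 0 < r ->
  [set v : mink R n | lorentz v v = - r ^+ 2 /\ 0 < s * last_coord v] =
  sheet n (- r ^+ 2) s.
Proof.
move=> ss r0; apply/seteqP; split=> v; have [x [p [q ->]]] := lcP v;
  rewrite /sheet /= lorentz_lc last_coord_lc pcoord_lc => -[Q sl]; split=> //;
  have := sqnorm_ge0 x; case: ss sl => -> /=; nra.
Qed.

(** On the null cone p q <= 0.  If p <> 0, then z has the sign of p; if p = 0,
    then x = 0 and the vector lies on the line of w0, with z = - q / 2: this is
    why the removed ray has the opposite sign. *)
Lemma sheet_cone (R : realType) (n : nat) (s : R) : is_sign s ->
  [set v : mink R n | lorentz v v = 0 /\ 0 < s * last_coord v] `\` ray n (- s) =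
  sheet n 0 s.
Proof.
move=> ss; apply/seteqP; split=> v; have [x [p [q ->]]] := lcP v;
  rewrite /sheet /= lorentz_lc last_coord_lc pcoord_lc.
  move=> [[Q sl] nray].
  have [p0|p0] := eqVneq p 0.
    case: nray; exists q; last first.
      by move: Q; rewrite p0 mul0r addr0 => /sqnorm_eq0 ->.
    by move: sl; rewrite p0 sub0r; nra.
  have := sqnorm_ge0 x.
  by case: ss sl p0 {nray} => -> /=; case: (ltgtP p 0) => //; nra.
move=> [Q sp]; split; first split=> //.
  have := sqnorm_ge0 x; case: ss sp => -> /=; nra.
by move=> [q' _ /lc_inj[_ p0 _]]; move: sp; rewrite p0 mulr0 ltxx.
Qed.

Lemma posrayE (R : realType) (n : nat) : posray R n = ray n 1.
Proof.
apply/seteqP; split=> v.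
  move=> [s s0 <-]; exists (s * 2); first by rewrite mul1r mulr_gt0.
  by rewrite -[LHS]add0r -lc0 w0_lc lc_lin !add0r scaler0 mulr0.
move=> [q q0 ->]; exists (q / 2); first by rewrite /= divr_gt0 // -[q]mul1r.
by rewrite -[LHS]add0r -lc0 w0_lc lc_lin !add0r scaler0 mulr0 divfK.
Qed.

Lemma negrayE (R : realType) (n : nat) : negray R n = ray n (- 1).
Proof.
apply/seteqP; split=> v.
  move=> [s /= s0 <-]; exists (s * 2); first by nra.
  by rewrite -[LHS]add0r -lc0 w0_lc lc_lin !add0r scaler0 mulr0.
move=> [q q0 ->]; exists (q / 2); first by rewrite /=; nra.
by rewrite -[LHS]add0r -lc0 w0_lc lc_lin !add0r scaler0 mulr0 divfK.
Qed.

Lemma HplusE (R : realType) (n : nat) (r : R) :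
  0 < r -> Hplus R n r = sheet n (- r ^+ 2) 1.
Proof.
move=> r0; rewrite -sheet_hyperbolic //; last by left.
by apply: eq_set => v; rewrite mul1r.
Qed.

Lemma HminusE (R : realType) (n : nat) (r : R) :
  0 < r -> Hminus R n r = sheet n (- r ^+ 2) (- 1).
Proof.
move=> r0; rewrite -sheet_hyperbolic //; last by right.
by apply: eq_set => v; rewrite mulN1r.
Qed.

Lemma CplusE (R : realType) (n : nat) :
  Cplus R n `\` negray R n = sheet n 0 1.
Proof.
rewrite -sheet_cone; last by left.
by rewrite negrayE; congr (_ `\` _); apply: eq_set => v; rewrite mul1r.
Qed.

Lemma CminusE (R : realType) (n : nat) :
  Cminus R n `\` posray R n = sheet n 0 (- 1).
Proof.
rewrite -sheet_cone; last by right.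
by rewrite opprK posrayE; congr (_ `\` _); apply: eq_set => v; rewrite mulN1r.
Qed.

Lemma W_hyperplaneP (R : realType) (n : nat) (v : mink R n) :
  W_hyperplane R n v <-> pcoord v = 0.
Proof.
have [x [p [q ->]]] := lcP v; rewrite pcoord_lc.
have lcE (y : 'cV[R]_n.-1) s : vec3 y 0 0 + s *: w0 R n = lc y 0 (s * 2).
  by rewrite vec3_lc w0_lc lc_lin scaler0 mulr0 !addr0 add0r.
split; first by move=> [y [s]]; rewrite lcE => /lc_inj[].
by move=> ->; exists x, (q / 2); rewrite lcE divfK.
Qed.

Lemma deSitter_minus_Z (R : realType) (n : nat) (r : R) :
  deSitter R n r `\` Z_cylinder R n r =
  sheet n (r ^+ 2) 1 `|` sheet n (r ^+ 2) (- 1).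
Proof.
apply/seteqP; split=> v.
  move=> [Sv nZ]; have p0 : pcoord v != 0.
    by apply/eqP => /W_hyperplaneP Wv; apply: nZ.
  have [s [] -> sv] := signP p0; [left | right]; split=> //.
have nW s : 0 < s * pcoord v -> ~ Z_cylinder R n r v.
  by move=> sv [/W_hyperplaneP pv _]; move: sv; rewrite pv mulr0 ltxx.
by move=> [] [Sv /nW nZ]; split.
Qed.

(** * Connected components of the complement of Z in de Sitter space *)

(** The image of the line through the origin in the direction a = (x, u)
    under the parametrisation of a sheet by x and u = log |p|.  All these curves
    start at the same point. *)
Definition sheet_curve (R : realType) (n : nat) (c s : R)
    (a : 'cV[R]_n.-1 * R) (t : R) : mink R n :=
  lc 0 (s * expR (t * a.2)) (s * (c - t ^+ 2 * sqnorm a.1) * expR (- (t * a.2)))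
  + t *: lc a.1 0 0.

Lemma sheet_curve_continuous (R : realType) (n : nat) (c s : R)
    (a : 'cV[R]_n.-1 * R) : continuous (sheet_curve c s a).
Proof.
(* A combination of fixed vectors reduces continuity to real functions. *)
have -> : sheet_curve c s a = fun t : R =>
    (s * expR (t * a.2)) *: lc 0 1 0 +
    (s * (c - t ^+ 2 * sqnorm a.1) * expR (- (t * a.2))) *: lc 0 0 1 +
    t *: lc a.1 0 0.
  apply/funext => t; rewrite /sheet_curve; congr (_ + _).
  rewrite -[X in _ = X + _]add0r -lc0 !lc_lin !scaler0 !addr0.
  by congr lc; ring.
move=> t; have cE (f : R -> R) :
    {for t, continuous f} -> {for t, continuous (expR \o f)}.
  by move=> cf; apply: continuous_comp => //; exact: continuous_expR.
have c1 : {for t, continuous (fun t : R => t * a.2)}.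
  by apply: continuousM; [exact: cvg_id | exact: cst_continuous].
have cD (f g : R -> mink R n) :
    {for t, continuous f} -> {for t, continuous g} ->
    {for t, continuous (fun z => f z + g z)} by move=> cf cg; exact: cvgD cf cg.
apply: (cD); [apply: (cD)|]; apply: continuousZr_tmp.
- by apply: continuousM; [exact: cst_continuous | exact: cE].
- apply: continuousM; last by apply: cE; exact: continuousN.
  apply: continuousM; first exact: cst_continuous.
  apply: continuousB; first exact: cst_continuous.
  by apply: continuousM; [exact: exprn_continuous | exact: cst_continuous].
- exact: cvg_id.
Qed.

(** A sheet is the union of the curves [sheet_curve], which share the point
    of parameter 0; with u = log |p|, parameter 1 reaches every point. *)
Lemma sheet_connected (R : realType) (n : nat) (c s : R) : is_sign s ->
  connected (sheet n c s).
Proof.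
move=> ss.
have -> : sheet n c s = \bigcup_(a in [set: 'cV[R]_n.-1 * R])
    (sheet_curve c s a @` [set: R]).
  have curveE (x : 'cV[R]_n.-1) u t : sheet_curve c s (x, u) t =
      lc (t *: x) (s * expR (t * u))
         (s * (c - t ^+ 2 * sqnorm x) * expR (- (t * u))).
    by rewrite /sheet_curve lc_lin add0r !mulr0 !addr0.
  have s2 := sign_sqr ss.
  apply/seteqP; split=> v.
    have [x [p [q ->]]] := lcP v; rewrite /sheet /= lorentz_lc pcoord_lc => -[Q sp].
    exists (x, ln (s * p)) => //; exists 1 => //; rewrite curveE.
    rewrite scale1r mul1r expRN lnK ?posrE // expr1n -Q.
    have p0 : p != 0 by apply: contraTneq sp => ->; rewrite mulr0 ltxx.
    have s0 : s != 0 by apply: contraTneq sp => ->; rewrite mul0r ltxx.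
    by congr lc; [ring: s2 | field; apply/andP].
  move=> [[x u] _ [t _ <-]]; rewrite curveE; split; last first.
    by rewrite pcoord_lc mulrA s2 mul1r expR_gt0.
  rewrite lorentz_lc sqnormZ.
  have eV := expRNK (t * u).
  by ring: s2 eV.
apply: bigcup_connected.
  exists (lc 0 s (s * c)) => -[x u] _; exists 0 => //.
  rewrite /sheet_curve /= scale0r addr0 !mul0r oppr0 expR0 expr2 !mul0r subr0.
  by rewrite !mulr1.
move=> a _; apply: connected_continuous_connected.
  by apply/connected_intervalP => x y _ _ z _.
by apply: continuous_subspaceT; exact: sheet_curve_continuous.
Qed.

Lemma pcoord_continuous (R : realType) (n : nat) : continuous (@pcoord R n).
Proof.
by move=> v; apply: (@continuousD _ R^o); exact: coord_continuous.
Qed.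

(** The coordinate p has an interval as image on a connected set, and this
    interval avoids 0 off Z: a component cannot meet both sheets. *)
Lemma sheet_component (R : realType) (n : nat) (c s : R) v : is_sign s ->
  sheet n c s v ->
  connected_component (sheet n c 1 `|` sheet n c (- 1)) v = sheet n c s.
Proof.
move=> ss Sv; apply/seteqP; split; last first.
  apply: connected_component_max => //; last exact: sheet_connected.
  by case: ss => ->; [left | right].
set C := connected_component _ v => w Cw.
have Cpcoord u : C u -> lorentz u u = c /\ pcoord u != 0.
  move=> /connected_component_sub[] [-> pu]; split => //;
  by apply: contraTneq pu => ->; rewrite mulr0 ltxx.
have [Qw w0] := Cpcoord _ Cw; split => //; rewrite ltNge; apply/negP => sw.
have Ci : is_interval (@pcoord R n @` C).
  apply/connected_intervalP; apply: connected_continuous_connected.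
    exact: component_connected.
  by apply: continuous_subspaceT; exact: pcoord_continuous.
have Cv : C v.
  apply: connected_component_refl.
  by case: ss Sv => -> Sv; [left | right].
have [u /Cpcoord[_ /eqP]] : (@pcoord R n @` C) 0; last by [].
case: Sv => _; case: ss sw => -> sw sv.
- apply: (Ci (pcoord w) (pcoord v)); [by exists w | by exists v |].
  by apply/andP; split; lra.
- apply: (Ci (pcoord v) (pcoord w)); [by exists v | by exists w |].
  by apply/andP; split; lra.
Qed.

Lemma deSitter_components (R : realType) (n : nat) (r : R) :
  components (deSitter R n r `\` Z_cylinder R n r) =
  [set sheet n (r ^+ 2) 1; sheet n (r ^+ 2) (- 1)].
Proof.
have s1 : is_sign (1 : R) by left.
have sN1 : is_sign (-1 : R) by right.
rewrite deSitter_minus_Z; apply/seteqP; split=> S.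
  move=> [v [] Sv <-]; rewrite (sheet_component _ Sv) //; [by left | by right].
move=> [] ->.
  exists (lc 0 1 (1 * r ^+ 2)); first by left; apply: sheet_neq0.
  exact/sheet_component/sheet_neq0.
exists (lc 0 (-1) (-1 * r ^+ 2)); first by right; apply: sheet_neq0.
exact/sheet_component/sheet_neq0.
Qed.

Lemma sheets_distinct (R : realType) (n : nat) (c : R) :
  sheet n c 1 <> sheet n c (- 1).
Proof.
move=> E; have [_] : sheet n c (- 1) (lc 0 1 (1 * c)).
  by rewrite -E; apply: sheet_neq0; left.
by rewrite pcoord_lc; lra.
Qed.

(** * The list of orbits *)

Section Classification.
Variables (R : realType) (n : nat) (K : set (minkmx R n)).
Hypotheses (sK : is_subgroup K) (KK0 : K `<=` K0_group R n).

Lemma sheet_is_orbit c s : is_sign s -> group_orbits (KAN K) (sheet n c s).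
Proof.
move=> ss; exists (lc 0 s (s * c)) => //.
rewrite (orbit_sheet sK KK0 _ _ ss) ?sign_sqr //.
by rewrite sqnorm0 add0r mulrA sign_sqr // mul1r.
Qed.

Lemma sheet_in_list c s : is_sign s -> orbit_list K (sheet n c s).
Proof.
move=> ss; case: (ltgtP c 0) => c0.
- constructor 1; exists (Num.sqrt (- c)); first by rewrite sqrtr_gt0 oppr_gt0.
  have rE : - Num.sqrt (- c) ^+ 2 = c by rewrite sqr_sqrtr ?opprK // oppr_ge0 ltW.
  rewrite HplusE ?HminusE ?sqrtr_gt0 ?oppr_gt0 // rE.
  by case: ss => ->; [left | right].
- constructor 3; exists (Num.sqrt c); first by rewrite sqrtr_gt0.
  left; rewrite deSitter_components sqr_sqrtr ?ltW //.
  by case: ss => ->; [left | right].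
- constructor 2; constructor 3; rewrite c0 CplusE CminusE.
  by case: ss => ->; [left | right].
Qed.

Lemma orbits_classified : group_orbits (KAN K) = orbit_list K.
Proof.
have s1 : is_sign (1 : R) by left.
have sN1 : is_sign (-1 : R) by right.
apply/seteqP; split=> S.
  move=> [v _ <-]; have [x [p [q ->]]] := lcP v.
  have [->|/signP[s ss sp]] := eqVneq p 0; last first.
    by rewrite (orbit_sheet sK KK0 _ _ ss sp); exact: sheet_in_list.
  have [->|x0] := eqVneq x 0; last first.
    have xgt0 : 0 < sqnorm x.
      rewrite lt_def sqnorm_ge0 andbT.
      by apply: contra_neq x0; exact: sqnorm_eq0.
    constructor 3; exists (Num.sqrt (sqnorm x)); first by rewrite sqrtr_gt0.
    right; exists (lc x 0 0); last exact: orbit_line.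
    exists x; first by rewrite /= sqr_sqrtr // ltW.
    exact: vec3_lc.
  constructor 2; have [->|/signP[s ss sq]] := eqVneq q 0.
    by constructor 1; rewrite lc0; exact: orbit_0.
  constructor 2; rewrite (orbit_ray sK KK0 ss sq) posrayE negrayE.
  by case: ss => ->; [left | right].
case.
- by move=> [r r0] [] ->; rewrite ?HplusE ?HminusE //; exact: sheet_is_orbit.
- case.
  + by move=> ->; exists 0 => //; exact: orbit_0.
  + have ray_orbit s : is_sign s -> group_orbits (KAN K) (ray n s).
      by move=> ss; exists (lc 0 0 s) => //; apply: orbit_ray; rewrite ?sign_sqr.
    by case=> ->; rewrite ?posrayE ?negrayE; exact: ray_orbit.
  + by case=> ->; rewrite ?CplusE ?CminusE; exact: sheet_is_orbit.
- move=> [r r0] [].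
    by rewrite deSitter_components => -[] ->; exact: sheet_is_orbit.
  move=> [_ [x /= xr <-] ->]; exists (lc x 0 0) => //.
  rewrite orbit_line ?vec3_lc //.
  apply: contraTneq r0 => x0; move: xr; rewrite x0 sqnorm0 => /esym/eqP.
  by rewrite sqrf_eq0 => /eqP ->; rewrite ltxx.
Qed.

End Classification.

(** * Cohomogeneity *)

Lemma is_derive_smooth_curve (R : realType) (m : nat) (c : R -> 'cV[R]_m)
    (i : 'I_m) :
  smooth_curve c ->
  is_derive (0 : R) 1 (fun t => c t i 0)
    ((\col_i derive1 (fun t => c t i 0) 0) i 0).
Proof.
move=> sc; rewrite mxE derive1E; apply: derivableP.
exact: (sc i 0%N 0).
Qed.

(** Differentiate the constant function <c(t), c(t)> at 0. *)
Lemma tangent_vector_level (R : realType) (n : nat) (S : set (mink R n)) a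
    (v u : mink R n) :
  (forall w, S w -> lorentz w w = a) -> tangent_vector S v u -> lorentz v u = 0.
Proof.
move=> Sa [c [sc cS <- uE]].
have dc i : is_derive (0 : R) 1 (fun t => c t i 0) (u i 0).
  by rewrite uE; exact: is_derive_smooth_curve.
pose f i : R -> R := (fun t => c t i 0) * (fun t => c t i 0).
have df i : is_derive (0 : R) 1 (f i) (2 * (c 0 i 0 * u i 0)).
  have := is_deriveM (dc i) (dc i); rewrite -/(f i) => dfi.
  by apply: (is_derive_eq dfi); rewrite /GRing.scale /=; ring.
pose z := rshift (n.-1 + 1) (ord0 : 'I_1).
have dl : is_derive (0 : R) 1 (\sum_(i < n.-1 + 1) f (lshift 1 i) - f z)
    (\sum_(i < n.-1 + 1) 2 * (c 0 (lshift 1 i) 0 * u (lshift 1 i) 0)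
     - 2 * (c 0 z 0 * u z 0)).
  by apply: is_deriveB.
have lE : \sum_(i < n.-1 + 1) f (lshift 1 i) - f z = cst a.
  apply/funext => t; rewrite -(Sa _ (cS t)) /lorentz.
  by rewrite -[LHS]/((\sum_(i < n.-1 + 1) f (lshift 1 i)) t - f z t) fct_sumE.
have := derive_val (is_derive := dl).
rewrite lE derive_cst -mulr_sumr -mulrBr => /esym/eqP.
by rewrite mulf_eq0 pnatr_eq0 /= => /eqP.
Qed.

(** Otherwise the family would be a basis, and h would vanish on every
    vector. *)
Lemma annihilated_free (R : realType) (m d : nat) (h : 'rV[R]_m)
    (X : d.-tuple 'cV[R]_m) :
  h != 0 -> free X -> (forall u, u \in X -> h *m u = 0) -> (d < m)%N.
Proof.
move=> h0 fX hX.
have dX : \dim <<X>> = d by rewrite (eqP fX) size_tuple.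
have dT : \dim {:'cV[R]_m} = m by rewrite dimvf /dim /= muln1.
have dm : (d <= m)%N by rewrite -dX -[leqRHS]dT dimvS ?subvf.
rewrite ltn_neqAle dm andbT {dm}.
apply: contra_neq h0 => dm.
have /eqP XT : <<X>>%VS == fullv by rewrite eqEdim subvf dX dT dm leqnn.
apply/rowP => i; rewrite mxE.
have : delta_mx i 0 \in <<X>>%VS by rewrite XT memvf.
move=> /coord_span E; have : h *m (delta_mx i 0 : 'cV[R]_m) = 0.
  rewrite E mulmx_sumr big1 // => j _.
  by rewrite -scalemxAr hX ?scaler0 // mem_nth // size_tuple.
by rewrite -colE => /colP/(_ 0); rewrite !mxE.
Qed.

Lemma tangent_dim_lt (R : realType) (m : nat) (S : set 'cV[R]_m) v
    (h : 'rV[R]_m) :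
  h != 0 -> (forall u, tangent_vector S v u -> h *m u = 0) ->
  (tangent_dim S v < m)%N.
Proof.
move=> h0 hS; have m0 : (0 < m)%N.
  by case: m S v h h0 {hS} => // S v h; rewrite (thinmx0 h) eqxx.
suff : (tangent_dim S v <= m.-1)%N by rewrite -ltnS prednK.
apply/bigmax_leqP => d /asboolP[X [fX XS]].
rewrite -ltnS prednK //; apply: (annihilated_free h0 fX) => u uX.
exact/hS/XS.
Qed.

Lemma tangent_dim_ge (R : realType) (m d : nat) (S : set 'cV[R]_m) v
    (X : d.-tuple 'cV[R]_m) :
  free X -> (forall u, u \in X -> tangent_vector S v u) ->
  (d <= tangent_dim S v)%N.
Proof.
move=> fX XS; have dm : (d < m.+1)%N.
  rewrite ltnS; have := dimvS (subvf <<X>>).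
  by rewrite (eqP fX) size_tuple dimvf /dim /= muln1.
apply: (@leq_bigmax_cond _ _ (fun i : 'I_m.+1 => i : nat) (Ordinal dm)).
by apply/asboolP; exists X.
Qed.

(** The linear form <v, .>, as a row vector. *)
Definition flat (R : realType) (n : nat) (v : mink R n) :
    'rV[R]_(n.-1 + 1 + 1) :=
  \row_i (if (i < n.-1 + 1)%N then v i 0 else - v i 0).

Lemma flatE (R : realType) (n : nat) (v u : mink R n) :
  flat v *m u = (lorentz v u)%:M.
Proof.
rewrite [LHS]mx11_scalar; congr (_%:M).
rewrite mxE big_split_ord /= big_ord1 /lorentz /last_coord; congr (_ + _).
  by apply: eq_bigr => i _; rewrite mxE /= ltn_ord.
by rewrite mxE /= addn0 ltnn mulNr.
Qed.

Lemma flat_neq0 (R : realType) (n : nat) (v : mink R n) : v != 0 -> flat v != 0.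
Proof.
apply: contra_neq => v0; apply/colP => i; rewrite mxE.
have /rowP/(_ i) := v0; rewrite !mxE; case: ifP => // _ /eqP.
by rewrite oppr_eq0 => /eqP.
Qed.

Lemma is_derive_exp_comb (R : realType) (a b t : R) :
  is_derive t 1 (fun t => a * expR t + b * expR (- t))
    (a * expR t + - b * expR (- t)).
Proof.
have dN : is_derive t 1 (fun t : R => expR (- t)) (- expR (- t)).
  have := is_derive1_comp (is_derive_expR (- t))
    (is_deriveN (is_derive_id t 1)).
  by rewrite mulrN1.
have dE := is_deriveD (is_deriveZ a (is_derive_expR t)) (is_deriveZ b dN).
by apply: (is_derive_eq dE); rewrite scalerN mulNr.
Qed.

Lemma derive1_exp_comb (R : realType) (a b : R) :
  derive1 (fun t => a * expR t + b * expR (- t)) =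
  fun t => a * expR t + - b * expR (- t).
Proof.
apply/funext => t; rewrite derive1E.
exact: (derive_val (is_derive := is_derive_exp_comb a b t)).
Qed.

(** The coefficients are generalised over because differentiation changes the
    sign of the second one. *)
Lemma derivable_exp_comb (R : realType) k (a b t : R) :
  derivable (derive1n k (fun t => a * expR t + b * expR (- t))) t 1.
Proof.
elim: k b => [|k IHk] b; last by rewrite derive1Sn derive1_exp_comb.
by have [] := is_derive_exp_comb a b t.
Qed.

(** The velocity at 0 of the hyperbola cosh t e_(n+1) + sinh t e_i. *)
Lemma hyperboloid_tangent (R : realType) (n : nat) (i : 'I_(n.-1 + 1)) :
  tangent_vector (Hplus R n 1) (vec3 0 0 1) (delta_mx (lshift 1 i) 0).
Proof.
pose z := rshift (n.-1 + 1) (ord0 : 'I_1).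
pose e : mink R n := delta_mx (lshift 1 i) 0.
have ez : e z 0 = 0 by rewrite mxE eq_rlshift.
have ei j : e (lshift 1 j) 0 = (j == i)%:R.
  by rewrite mxE (inj_eq (@lshift_inj _ _)) andbT.
have vz j : vec3 0 0 1 j 0 = (j == z)%:R :> R.
  rewrite /vec3 raddf0 col_mx0; case: (split_ordP j) => k ->.
    by rewrite col_mxEu mxE eq_lrshift.
  by rewrite col_mxEd [k]ord1 mxE /z !eqxx.
exists (fun t => sinh t *: e + cosh t *: vec3 0 0 1).
have cE t j : (sinh t *: e + cosh t *: vec3 0 0 1 : mink R n) j 0 =
    sinh t * e j 0 + cosh t * (j == z)%:R.
  by rewrite mxE [X in X + _]mxE [X in _ + X]mxE vz.
have cexp j : (fun t => (sinh t *: e + cosh t *: vec3 0 0 1 : mink R n) j 0) =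
    fun t => ((j == z)%:R + e j 0) / 2 * expR t +
             ((j == z)%:R - e j 0) / 2 * expR (- t).
  by apply/funext => t; rewrite cE /sinh /cosh; field.
split.
- by move=> j k t; rewrite cexp; exact: derivable_exp_comb.
- move=> t; set w := _ + _; have wE j : w j 0 = _ := cE t j.
  have lw : last_coord w = cosh t.
    by rewrite /last_coord wE ez eqxx mulr0 add0r mulr1.
  split; last by rewrite lw divr_gt0 // addr_gt0 // expR_gt0.
  rewrite /lorentz lw (bigD1 i) //= big1 => [|j ji].
    rewrite wE ei eq_lrshift eqxx mulr1 mulr0 !addr0 /sinh /cosh.
    have tV := expRNK t.
    by field: tV.
  by rewrite wE ei eq_lrshift (negbTE ji) !mulr0 addr0 mul0r.
- rewrite /sinh /cosh oppr0 expR0 subrr mul0r scale0r add0r -mulr2n.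
  by rewrite divff ?scale1r.
- apply/colP => j; rewrite [RHS]mxE cexp derive1_exp_comb oppr0 expR0 -/e.
  by field.
Qed.

Lemma free_delta (R : realType) (k : nat) :
  free [tuple (delta_mx (lshift 1 i) 0 : 'cV[R]_(k + 1)) | i < k].
Proof.
apply/freeP => a; move=> + i => /colP/(_ (lshift 1 i)).
rewrite summxE mxE (bigD1 i) //= big1 => [|j ji].
  by rewrite (nth_map i) ?size_enum_ord // nth_ord_enum !mxE !eqxx mulr1 addr0.
rewrite (nth_map j) ?size_enum_ord // nth_ord_enum !mxE.
by rewrite (inj_eq (@lshift_inj _ _)) eq_sym (negbTE ji) mulr0.
Qed.

(** Every tangent space lies in a hyperplane: the orthogonal of v for v <> 0,
    and any hyperplane at the fixed point 0.  The orbit of e_(n+1) attains this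
    bound. *)
Lemma KAN_cohomogeneity (R : realType) (n : nat) (K : set (minkmx R n)) :
  is_subgroup K -> K `<=` K0_group R n -> has_cohomogeneity (KAN K) 1.
Proof.
move=> sK KK0.
have lt_dim v : (tangent_dim (group_orbit (KAN K) v) v < n.-1 + 1 + 1)%N.
  have [->|v0] := eqVneq v 0; last first.
    apply: (tangent_dim_lt (flat_neq0 v0)) => u tu; rewrite flatE.
    rewrite (tangent_vector_level (a := lorentz v v) _ tu) ?raddf0 //.
    move=> _ [g Kg <-].
    exact: (KAN_lorentz KK0).
  (* The orbit of 0 has no nonzero tangent vector, so any nonzero form will
     do; take <e_(n+1), .>. *)
  rewrite (orbit_0 sK KK0).
  have w_neq0 : vec3 0 0 1 != 0 :> mink R n.
    apply/eqP => /(congr1 (@last_coord R n)).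
    by rewrite last_coord_vec3 /last_coord mxE => /eqP; rewrite oner_eq0.
  apply: (tangent_dim_lt (flat_neq0 w_neq0)) => _ [c [sc c0 _ ->]].
  apply/colP => j; rewrite mxE big1 ?mxE // => i _; rewrite [X in _ * X]mxE.
  have -> : (fun t => c t i 0) = cst 0; last by rewrite derive1_cst mulr0.
  by apply/funext => t; rewrite c0 mxE.
split; last by move=> v; rewrite /orbit_codim subn_gt0.
exists (vec3 0 0 1); apply/eqP; rewrite eqn_leq /orbit_codim subn_gt0 lt_dim andbT.
rewrite leq_subLR leq_add2r.
have -> : group_orbit (KAN K) (vec3 0 0 1) = Hplus R n 1.
  have -> : vec3 0 0 1 = lc 0 1 (- 1) :> mink R n by congr vec3; lra.
  rewrite (orbit_sheet sK KK0 (s := 1)) ?mulr1 //; last by left.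
  by rewrite HplusE // sqnorm0 mul1r add0r expr1n.
apply: (tangent_dim_ge (free_delta R (n.-1 + 1))) => u /mapP[i _ ->].
exact: hyperboloid_tangent.
Qed.

Theorem theorem4p2 (R : realType) (n : nat) (hn : (3 <= n)%N)
    (K' : set (minkmx R n)) (hK' : is_subgroup K') (hK0 : K' `<=` K0_group R n) :
  [/\ is_subgroup (KAN K'),
      has_cohomogeneity (KAN K') 1,
      (forall r : R, 0 < r ->
         exists C1 C2 : set (mink R n),
           C1 <> C2 /\
           components (deSitter R n r `\` Z_cylinder R n r) = [set C1; C2]) &
      group_orbits (KAN K') = orbit_list K'].
Proof.
split; [exact: KAN_subgroup | exact: KAN_cohomogeneity | |
        exact: orbits_classified].
move=> r _; exists (sheet n (r ^+ 2) 1), (sheet n (r ^+ 2) (- 1)).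
by split; [exact: sheets_distinct | exact: deSitter_components].
Qed.
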